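(* For $0<\gamma\leqslant 1$ define $$g(\gamma):=\limsup_{n\to\infty}\frac{e_{\lfloor \gamma n\rfloor}(n)}{n}.$$ Then: (1) for $0<\gamma\leqslant 1/2$ we have $2\gamma\leqslant g(\gamma)\leqslant 1$; (2) for $1/2<\gamma\leqslant 1$ we have $g(\gamma)=0$.
   Context: For $n\geqslant 1$, $Q_n$ denotes the $n$-dimensional hypercube: its vertices are all binary sequences $x=(x_i)_{i=1,\dots,n}$, and it is equipped with the Hamming distance $\rho(x,y)=|\{i : x_i\neq y_i\}|$ (the shortest-path metric of the hypercube graph). For a positive integer $d$, a non-empty subset $S\subseteq Q_n$ is called $d$-equilateral if $\rho(x,y)=d$ for all distinct $x,y\in S$. $e_d(n)$ denotes the maximal cardinality of a $d$-equilateral subset of $Q_n$ (so $e_d(n)=1$ if $d>n$). *)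

(* Defs.v *)
From mathcomp Require Import all_boot all_order all_algebra.
From mathcomp Require Import all_classical all_reals all_analysis.

Set Implicit Arguments.
Unset Strict Implicit.
Unset Printing Implicit Defensive.

Import Order.TTheory GRing.Theory Num.Theory.

Definition cube (n : nat) : finType := {ffun 'I_n -> bool}.

Definition hamming (n : nat) (x y : cube n) : nat :=
  #|[pred i : 'I_n | x i != y i]|.

Definition equilateral (n d : nat) (S : {set cube n}) : bool :=
  (S != finset.set0) &&
  [forall x in S, forall y in S, (x != y) ==> (hamming x y == d)].

(* The family over which the maximum is taken is never empty, since singletons
   are d-equilateral.  The value d = 0 is not excluded; then only singletons
   qualify and equilateral_max 0 n = 1. *)
Definition equilateral_max (d n : nat) : nat :=
  \max_(S : {set cube n} | equilateral d S) #|S|.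

Local Open Scope ring_scope.

(* The floor is an int; absz casts it to nat, and is the identity on it as long
   as 0 <= gamma.  The terms with n = 0 or floor (gamma * n) = 0 are finitely
   many when 0 < gamma, so they do not affect the upper limit.  The limsup is
   taken in the extended reals, where it exists without any boundedness
   assumption. *)
Definition g (R : realType) (gamma : R) : \bar R :=
  limn_esup (fun n : nat =>
    ((equilateral_max `|Num.floor (gamma * n%:R)|%N n)%:R / n%:R)%:E).

(* Main.v *)
(** A (2^r)-equilateral set of 2^(r+1) points of Q_n, n >= 2^(r+1), is given by
    the rows of a Sylvester-Hadamard matrix, padded with zeros; taking n minimal
    with floor (gamma n) = 2^r gives the lower bound 2 gamma.  Viewing vertices
    as +-1 vectors, the points of a d-equilateral set S have Gram matrix
    2d I + (n - 2d) J.  Its rank is at most n, so #|S| <= n + 1; and it is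
    positive semidefinite, so #|S| (2d - n) <= 2d, which keeps #|S| bounded when
    d / n stays above 1/2. *)
Require Import Defs.
From mathcomp Require Import all_boot all_order all_algebra.
From mathcomp Require Import all_classical all_reals all_analysis.
From mathcomp Require Import ring lra.

Set Implicit Arguments.
Unset Strict Implicit.
Unset Printing Implicit Defensive.

Import Order.TTheory GRing.Theory Num.Theory.
Local Open Scope ring_scope.

(** * Upper bounds from inner products of sign vectors *)

Lemma sum_sign_mul (R : pzRingType) (n : nat) (x y : cube n) :
  \sum_i (-1) ^+ x i * (-1) ^+ y i = n%:R - (hamming x y).*2%:R :> R.
Proof.
rewrite (eq_bigr (fun i => 1 - (x i != y i)%:R *+ 2)); last first.
  move=> i _; rewrite -signr_addb.
  case: (x i); case: (y i); rewrite /= ?expr0 ?expr1 ?mul0rn ?subr0 //;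
    by rewrite mulr2n opprD addNKr.
rewrite sumrB sumr_const card_ord sumrMnl -natr_sum -mul2n natrM mulr_natl.
congr (_ - _%:R *+ 2); rewrite /hamming -sum1_card [in RHS]big_mkcond /=.
by apply: eq_bigr => i _; rewrite inE; case: (_ != _).
Qed.

Lemma hamming_eq0 (n : nat) (x y : cube n) : (hamming x y == 0%N) = (x == y).
Proof.
apply/eqP/eqP => [/card0_eq h|->]; last first.
  by apply: eq_card0 => i; rewrite inE eqxx.
by apply/ffunP => i; have := h i; rewrite !inE => /negbFE/eqP.
Qed.

Lemma equilateral_hamming (n d : nat) (S : {set cube n}) (x y : cube n) :
  equilateral d S -> x \in S -> y \in S -> hamming x y = ((x != y) * d)%N.
Proof.
move=> /andP[_ /forall_inP h] xS yS; have [->|xy] := eqVneq x y.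
  by apply/eqP; rewrite hamming_eq0.
by rewrite mul1n; have /forall_inP/(_ y yS)/implyP/(_ xy)/eqP := h x xS.
Qed.

(** The Gram matrix [A *m A^T] has rank at most n and the correction [u *m v] rank at most 1, while
    their sum 2d I has full rank [#|S|]. *)
Lemma equilateral_card_leS (n d : nat) (S : {set cube n}) :
  equilateral d S -> (#|S| <= n.+1)%N.
Proof.
move=> eqS; case: d => [|d] in eqS *.
  (* For d = 0 the matrix 2d I vanishes and the rank argument fails. *)
  apply: (@leq_trans 1) => //; apply/card_le1_eqP => x y xS yS.
  by apply/eqP; rewrite -hamming_eq0 (equilateral_hamming eqS) // muln0.
pose A : 'M[rat]_(#|S|, n) :=
  \matrix_(i, j) (-1) ^+ (@enum_val (cube n) (mem S) i) j.
pose u : 'cV[rat]_#|S| := const_mx (d.+1.*2%:R - n%:R).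
pose v : 'rV[rat]_#|S| := const_mx 1.
have gram : A *m A^T + u *m v = d.+1.*2%:R *: 1%:M.
  apply/matrixP => i j; rewrite !mxE big_ord1 !mxE.
  under eq_bigr do rewrite !mxE.
  rewrite sum_sign_mul (equilateral_hamming eqS (enum_valP i) (enum_valP j)).
  rewrite (inj_eq enum_val_inj); case: eqVneq => _ /=.
    by rewrite mul0n double0; ring.
  by rewrite mul1n; ring.
have := mxrank_add (A *m A^T) (u *m v).
rewrite gram mxrank_scale_nz ?mxrank1 ?pnatr_eq0 // => /leq_trans; apply.
by rewrite -[n.+1]addn1 leq_add ?mulmx_max_rank.
Qed.

(* Plotkin's argument: the +-1 vectors of S have a sum of nonnegative norm. *)
Lemma equilateral_plotkin (n d : nat) (S : {set cube n}) :
  equilateral d S -> (#|S| * (d.*2 - n) <= d.*2)%N.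
Proof.
move=> eqS; have S_gt0 : (0 < #|S|)%N by case/andP: eqS; rewrite card_gt0.
have : 0 <= \sum_i (\sum_(x in S) (-1) ^+ x i) ^+ 2 :> int.
  by apply: sumr_ge0 => i _; exact: sqr_ge0.
under eq_bigr => i _.
  rewrite expr2 mulr_suml; under eq_bigr do rewrite mulr_sumr; over.
rewrite exchange_big /=; under eq_bigr do rewrite exchange_big /=.
(* Each x contributes n - 2d (#|S| - 1) + n (#|S| - 1) to the squared norm, independently of x. *)
under eq_bigr => x xS.
  under eq_bigr => y yS do rewrite sum_sign_mul (equilateral_hamming eqS) //.
  rewrite (bigD1 x) //= eqxx mul0n double0 subr0.
  under eq_bigr => y /andP[_ yx] do rewrite eq_sym yx mul1n.
  have cardSx : #|[pred y | (y \in S) && (y != x)]| = #|S|.-1.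
    rewrite [in RHS](cardsD1 x) xS add1n /=.
    by apply: eq_card => y; rewrite !inE andbC.
  rewrite sumr_const cardSx.
  over.
rewrite sumr_const pmulrn_lge0 //.
(* If 2d <= n, the truncated difference [d.*2 - n] is 0 and the bound is trivial. *)
have [dn|/ltnW/subnKC <-] := leqP d.*2 n.
  by move: dn; rewrite -subn_eq0 => /eqP ->; rewrite muln0.
rewrite addKn natrD opprD addNKr mulNrn subr_ge0 -mulrnA ler_nat => le_n.
by rewrite -(prednK S_gt0) mulSn addnC leq_add2r mulnC.
Qed.

Lemma equilateral_max_leS (d n : nat) : (equilateral_max d n <= n.+1)%N.
Proof. by apply/bigmax_leqP => S; exact: equilateral_card_leS. Qed.

Lemma equilateral_max_plotkin (d n : nat) :
  (equilateral_max d n * (d.*2 - n) <= d.*2)%N.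
Proof.
rewrite /equilateral_max; elim/big_ind: _ => // [a b ha hb|S].
  by rewrite maxnMl geq_max ha.
exact: equilateral_plotkin.
Qed.

(** * Lower bound from Sylvester-Hadamard matrices *)

Lemma leq_equilateral_max (I T : finType) (n d : nat) (F : T -> I -> bool) :
  (#|I| <= n)%N -> (0 < d)%N -> (0 < #|T|)%N ->
  (forall a b, a != b -> #|[pred i | F a i != F b i]| = d) ->
  (#|T| <= equilateral_max d n)%N.
Proof.
move=> leIn d_gt0 T_gt0 hF.
pose w (i : I) : 'I_n := widen_ord leIn (enum_rank i).
have w_inj : injective w by move=> i j /(congr1 val) /= /val_inj/enum_rank_inj.
(* The word [F a] is copied along [w] and padded with [false], which preserves distances; since d >
   0, distinct indices give distinct points. *)
pose f (a : T) : cube n := [ffun j => [exists i, (w i == j) && F a i]].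
have fw a i : f a (w i) = F a i.
  rewrite ffunE; apply/existsP/idP => [[k /andP[/eqP/w_inj ->]]|Fai] //.
  by exists i; rewrite eqxx.
have hf a b : hamming (f a) (f b) = #|[pred i | F a i != F b i]|.
  rewrite -(card_imset _ w_inj) /hamming; apply: eq_card => j; rewrite inE.
  apply/idP/imsetP => [|[i ]]; last by rewrite inE => ? ->; rewrite !fw.
  case: (pickP (fun i => w i == j)) => [i /eqP <-|noi].
    by rewrite !fw => ?; exists i.
  suff f0 c : f c j = false by rewrite !f0.
  by rewrite ffunE; apply/existsP => -[i]; rewrite noi.
have f_inj : injective f.
  move=> a b /eqP; rewrite -hamming_eq0 hf; apply: contraTeq => /hF ->.
  by rewrite -lt0n.
rewrite -[#|T|]cardsT -(card_imset _ f_inj).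
apply: (@leq_bigmax_cond _ (equilateral d) (fun S => #|S|)).
apply/andP; split; first by rewrite -card_gt0 (card_imset _ f_inj) cardsT.
apply/forall_inP => _ /imsetP[a _ ->]; apply/forall_inP => _ /imsetP[b _ ->].
by rewrite (inj_eq f_inj) hf; apply/implyP => /hF ->.
Qed.

(* (-1) ^+ bdot a t is the (a, t) entry of the Sylvester matrix. *)
Definition bdot (r : nat) (a t : cube r) : bool :=
  \big[addb/false]_i (a i && t i).

(* Flipping a coordinate at which a and b differ exchanges the t with
   bdot a t = bdot b t and those with bdot a t <> bdot b t. *)
Lemma card_bdot_neq (r : nat) (a b : cube r.+1) :
  a != b -> #|[pred t | bdot a t != bdot b t]| = (2 ^ r)%N.
Proof.
move=> ab; have [j abj] : exists j, a j != b j.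
  apply/existsP; apply: contraNT ab; rewrite negb_exists => /forallP h.
  by apply/eqP/ffunP => j; apply/eqP; have := h j; rewrite negbK.
pose flip (t : cube r.+1) : cube r.+1 := [ffun i => (i == j) (+) t i].
have flipK : involutive flip.
  by move=> t; apply/ffunP => i; rewrite !ffunE addKb.
have bdot_flip c t : bdot c (flip t) = c j (+) bdot c t.
  rewrite /bdot (bigD1 j) //= [in RHS](bigD1 j) //= !ffunE eqxx.
  rewrite (eq_bigr (fun i => c i && t i)) => [|i /negPf ij]; last first.
    by rewrite ffunE ij.
  by case: (c j); case: (t j); rewrite //= negbK.
set P := [pred _ | _].
have PC : #|[predC P]| = #|P|.
  rewrite -(card_imset P (inv_inj flipK)); apply: eq_card => t.
  rewrite -[in RHS](flipK t) finset.mem_imset; last exact: inv_inj.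
  rewrite !inE !bdot_flip negbK; move: abj.
  by case: (a j); case: (b j); case: (bdot a t); case: (bdot b t).
have := cardC P; rewrite PC addnn card_ffun card_bool card_ord expnS mul2n.
exact: double_inj.
Qed.

(** Rows and columns are both indexed by [cube r.+1], and two distinct rows differ in exactly half
    of the columns. *)
Lemma equilateral_max_sylvester (r n : nat) :
  (2 ^ r.+1 <= n)%N -> (2 ^ r.+1 <= equilateral_max (2 ^ r) n)%N.
Proof.
have cT : #|cube r.+1| = (2 ^ r.+1)%N by rewrite card_ffun card_bool card_ord.
rewrite -{1 2}cT => len; apply: leq_equilateral_max len _ _ _.
- by rewrite expn_gt0.
- by rewrite cT expn_gt0.
- exact: card_bdot_neq.
Qed.

(** * Passage to the limit superior *)

Lemma limn_esup_le (R : realType) (u : nat -> R) (l : R) :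
  (forall e, 0 < e -> \forall n \near \oo%classic, u n <= l + e) ->
  (limn_esup (fun n => (u n)%:E) <= l%:E)%E.
Proof.
move=> h; apply/lee_addgt0Pr => e e_gt0; rewrite -EFinD.
pose V := [set n | u n <= l + e]%classic.
apply: (@le_trans _ _ (ereal_sup [set (u n)%:E | n in V]%classic)).
  by apply: ereal_inf_lbound; exists V; [exact: h|].
by apply: ge_ereal_sup => _ [n /= un <-]; rewrite lee_fin.
Qed.

Lemma limn_esup_ge (R : realType) (u : nat -> R) (l : R) :
  (forall e N, 0 < e -> exists2 n, (N <= n)%N & l - e <= u n) ->
  (l%:E <= limn_esup (fun n => (u n)%:E))%E.
Proof.
move=> h; apply/lee_addgt0Pr => e e_gt0; rewrite -leeBlDr // -EFinB.
(* The upper limit is the infimum of the suprema over the sets V near infinity; each V contains a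
   tail, where [h] finds a large term. *)
apply: le_ereal_inf_tmp => _ [V [N _ NV] <-].
have [n Nn un] := h e N e_gt0.
apply: (@le_trans _ _ (u n)%:E); first by rewrite lee_fin.
by apply: ereal_sup_ubound; exists n => //; exact: NV.
Qed.

Lemma g_trunc (R : realType) (gamma : R) : 0 <= gamma ->
  g gamma = limn_esup (fun n =>
    ((equilateral_max (Num.trunc (gamma * n%:R)) n)%:R / n%:R)%:E).
Proof.
move=> gamma_ge0; congr limn_esup; apply/funext => n.
by rewrite truncn_floor mulr_ge0.
Qed.

Lemma g_le1 (R : realType) (gamma : R) : 0 <= gamma -> (g gamma <= 1%:E)%E.
Proof.
move=> gamma_ge0; rewrite g_trunc //; apply: limn_esup_le => e e_gt0.
near=> n.
have n_ge : e^-1 <= n%:R by near: n; exact: nbhs_infty_ger.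
have n_gt0 : 0 < n%:R :> R by apply: lt_le_trans n_ge; rewrite invr_gt0.
rewrite ler_pdivrMr // mulrDl mul1r.
apply: (@le_trans _ _ n.+1%:R); first by rewrite ler_nat equilateral_max_leS.
by rewrite -natr1 lerD2l mulrC -ler_pdivrMr // div1r.
Unshelve. all: by end_near. Qed.

Lemma g_gt_half (R : realType) (gamma : R) : 1 / 2 < gamma -> g gamma = 0%:E.
Proof.
move=> gamma_gt; have gamma_ge0 : 0 <= gamma by lra.
rewrite g_trunc //; apply/eqP; rewrite eq_le; apply/andP; split; last first.
  apply: limn_esup_ge => e N e_gt0; exists N => //.
  by apply: (@le_trans _ _ 0); [lra | rewrite divr_ge0].
pose c := 2 * gamma - 1; have c_gt0 : 0 < c by rewrite /c; lra.
apply: limn_esup_le => e e_gt0; near=> n; rewrite add0r.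
(* This absorbs the rounding in d: 2d - n > c n - 2 >= c n / 2. Plotkin's bound then gives m <= 4
   gamma / c, and the next condition makes this at most e n. *)
have n_ge : 4 / c <= n%:R by near: n; exact: nbhs_infty_ger.
have n_ge' : 4 * gamma / c / e <= n%:R by near: n; exact: nbhs_infty_ger.
have n_gt0 : 0 < n%:R :> R by apply: lt_le_trans n_ge; rewrite divr_gt0.
rewrite ler_pdivrMr //.
have /andP[] := truncn_itv (mulr_ge0 gamma_ge0 (ltW n_gt0)).
set d := Num.trunc _; rewrite -natr1 => d_le d_gt.
move: (equilateral_max_plotkin d n); set m := equilateral_max d n.
move: n_ge n_ge'; rewrite !ler_pdivrMr // => n_ge n_ge'.
have dn : c * n%:R / 2 <= d.*2%:R - n%:R.
  by rewrite -muln2 natrM; rewrite /c in n_ge *; lra.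
have nd : (n <= d.*2)%N.
  rewrite -(ler_nat R) -subr_ge0 (le_trans _ dn) //.
  by rewrite divr_ge0 // mulr_ge0 // ltW.
rewrite -(ler_nat R) natrM natrB // => plotkin.
have m_le : m%:R * c <= 4 * gamma.
  rewrite -(ler_pM2r n_gt0).
  have : m%:R * (c * n%:R / 2) <= m%:R * (d.*2%:R - n%:R) by rewrite ler_wpM2l.
  move: plotkin; rewrite -muln2 natrM; lra.
rewrite mulrC -(ler_pM2r c_gt0); apply: (le_trans m_le); lra.
Unshelve. all: by end_near. Qed.

Lemma le_g (R : realType) (gamma : R) : 0 < gamma -> gamma <= 1 / 2 ->
  ((2 * gamma)%:E <= g gamma)%E.
Proof.
move=> gamma_gt0 gamma_le; rewrite g_trunc; last exact: ltW.
apply: limn_esup_ge => e N e_gt0.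
(* As r < 2^r <= n, this choice forces both n >= N and n >= 2 gamma / e. *)
pose r := maxn N (Num.trunc (2 * gamma / e)).+1; pose d := (2 ^ r)%N.
have d_ge : (r < d)%N by exact: ltn_expl.
have d_gt0 : 0 < d%:R :> R by rewrite ltr0n expn_gt0.
pose n := `|Num.ceil (d%:R / gamma)|%N.
have nE : n%:R = (Num.ceil (d%:R / gamma))%:~R :> R.
  rewrite natr_absz ger0_norm // -(ler_int R).
  by apply: le_trans (ceil_ge _); rewrite divr_ge0 ?ltW.
have /andP[] := ceil_itv (d%:R / gamma); rewrite intrB -nE.
rewrite ltr_pdivlMr // ler_pdivrMr // => n_lt n_ge.
have dn : (d.*2 <= n)%N.
  rewrite -(ler_nat R) -muln2 natrM; nra.
(* Minimality of n gives d <= gamma n < d + gamma < d + 1. *)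
have dE : Num.trunc (gamma * n%:R) = d.
  by apply: truncn_def; rewrite -natr1; apply/andP; split; nra.
have Nn : (N <= n)%N.
  apply: leq_trans dn; rewrite -addnn; apply: leq_trans (leq_addr _ _).
  by apply: ltnW; apply: leq_ltn_trans d_ge; exact: leq_maxl.
exists n => //; rewrite dE.
have n_gt0 : 0 < n%:R :> R.
  by rewrite ltr0n (leq_trans _ dn) // double_gt0 expn_gt0.
rewrite ler_pdivlMr //.
apply: (@le_trans _ _ d.*2%:R); last first.
  by rewrite ler_nat -mul2n -expnS equilateral_max_sylvester // expnS mul2n.
(* Since 2d > 2 gamma n - 2 gamma, it remains to bound the loss 2 gamma by e n. *)
have : 2 * gamma / e <= n%:R.
  have r_ge0 : 0 <= 2 * gamma / e by rewrite divr_ge0 ?mulr_ge0 // ltW.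
  have /andP[_ /ltW/le_trans] := truncn_itv r_ge0.
  apply; rewrite ler_nat (leq_trans _ dn) // -addnn.
  apply: leq_trans (leq_addr _ _); apply: ltnW.
  by apply: leq_ltn_trans d_ge; exact: leq_maxr.
rewrite ler_pdivrMr // -muln2 natrM => ?; nra.
Qed.

Theorem theorem3p1 (R : realType) :
  (forall gamma : R, 0 < gamma -> gamma <= 1 / 2 ->
     ((2 * gamma)%:E <= g gamma)%E /\ (g gamma <= 1%:E)%E) /\
  (forall gamma : R, 1 / 2 < gamma -> gamma <= 1 -> g gamma = 0%:E).
Proof.
split=> gamma; last by move=> gamma_gt _; exact: g_gt_half.
by move=> gamma_gt0 gamma_le; split; [exact: le_g | exact/g_le1/ltW].
Qed.
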